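(* Assume $CA^\Delta$. Then there is a metric $d$ on $\omega_1$ such that the metric space $(\omega_1,d)$ has no uncountable monotone subspace.
   Context: For $c>0$, a metric space $(Y,d)$ is $c$-monotone if there is a linear order $\prec$ on $Y$ such that $d(x,y)\leq c\cdot d(x,z)$ whenever $x\prec y\prec z$; it is monotone if it is $c$-monotone for some $c>0$. $CA^\Delta$ is the statement: (i) for every $n\geq2$ and every good type $\tau$ with $n_k\geq n$ for all $k\geq1$ there is an $n$-$\Delta$-capturing construction scheme of type $\tau$ over $\omega_1$; (ii) for every good type $\tau$ with $\langle n_{k+1}\rangle_{k\in\omega}$ non-decreasing and unbounded there is a $\Delta$-capturing construction scheme of type $\tau$ over $\omega_1$. Definitions: a type is a sequence $\tau=\langle m_k,n_{k+1},r_{k+1}\rangle_{k\in\omega}$ of natural numbers with $m_0=1$ and, for all $k$, $n_{k+1}\geq2$, $m_k>r_{k+1}$, $m_{k+1}=r_{k+1}+(m_k-r_{k+1})n_{k+1}$; good if every $r$ equals $r_k$ for infinitely many $k\geq1$. $A<B$ means every element of $A$ is below every element of $B$; $D(a)$ is the $a$-th element of a finite set of ordinals $D$. A construction scheme of type $\tau$ over a set of ordinals $Y$ is a family $\mathcal{F}$ of nonempty finite subsets of $Y$, cofinal among finite subsets of $Y$ under $\subseteq$, each of size $m_k$ for some $k$, with $\mathcal{F}_k=\{F\in\mathcal{F}:|F|=m_k\}$ satisfying: (i) for $E,F\in\mathcal{F}_k$, $E\cap F$ is an initial segment of both; (ii) every $F\in\mathcal{F}_{k+1}$ equals $F_0\cup\dots\cup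 F_{n_{k+1}-1}$ with $F_i\in\mathcal{F}_k$ a $\Delta$-system with root $R(F)$, $|R(F)|=r_{k+1}$, $R(F)<F_0\setminus R(F)<\dots<F_{n_{k+1}-1}\setminus R(F)$. $\rho(\alpha,\beta)=\min\{k:\exists F\in\mathcal{F}_k\ \{\alpha,\beta\}\subseteq F\}$; $\lVert\alpha\rVert_k=|\{\xi<\alpha:\rho(\xi,\alpha)\leq k\}|$; $\Delta(\alpha,\beta)=\min\{k:\lVert\alpha\rVert_k\neq\lVert\beta\rVert_k\}$ ($\omega$ if none); for $k\geq1$, $\Xi_\alpha(k)=-1$ if $\alpha\in R(F)$, $=i$ if $\alpha\in F_i\setminus R(F)$, for any $F\in\mathcal{F}_k$ containing $\alpha$. A root-tail-tail $\Delta$-system is a sequence $\langle D_i\rangle_{i<n}$, $n\geq2$, of finite sets of ordinals of common size $m$ with pairwise intersections $R$, $R<D_i\setminus R$, $D_0\setminus R<\dots<D_{n-1}\setminus R$; $r=|R|$. It is $\Delta$-captured at level $l\geq1$ if $n\leq n_l$, (I) $\Xi_{D_i(a)}(l)=-1$ for $a<r$ and $=i$ for $a\geq r$ ($i<n$, $a<m$), and (II) $\Delta(D_i(a),D_j(a))=l$ for $i<j<n$, $r\leq a<m$. A scheme over $\omega_1$ is $n$-$\Delta$-capturing if for every uncountable family $\mathcal{S}$ of nonempty finite subsets of $\omega_1$ there are infinitely many $l$ for which some $n$ distinct members of $\mathcal{S}$, suitably enumerated, form a root-tail-tail $\Delta$-system $\Delta$-captured at level $l$; $\Delta$-capturing means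 $n$-$\Delta$-capturing for every $n\geq2$. *)

(* Defs.v *)
From Stdlib Require Import Reals List Sorted ZArith Arith.
Import ListNotations.

Section CA.

Context {T : Type} (ltT : T -> T -> Prop).

Definition countable_set (Y : T -> Prop) : Prop :=
  exists f : T -> nat, forall x y, Y x -> Y y -> f x = f y -> x = y.

Definition uncountable_set (Y : T -> Prop) : Prop := ~ countable_set Y.

Definition is_omega1 : Prop :=
  (forall x, ~ ltT x x) /\
  (forall x y z, ltT x y -> ltT y z -> ltT x z) /\
  (forall x y, x <> y -> ltT x y \/ ltT y x) /\
  well_founded ltT /\
  uncountable_set (fun _ => True) /\
  (forall a, countable_set (fun x => ltT x a)).

(* A finite set of ordinals is represented by its strictly increasing
   enumeration (a list); D(a) is then nth_error D a. *)
Definition fset_ok (D : list T) : Prop := StronglySorted ltT D.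

Definition set_lt (A B : T -> Prop) : Prop :=
  forall x y, A x -> B y -> ltT x y.

Definition uncountable_family (S : list T -> Prop) : Prop :=
  ~ exists f : list T -> nat,
      forall D1 D2, S D1 -> S D2 -> f D1 = f D2 -> D1 = D2.

Definition rtt_delta (Ds : nat -> list T) (k : nat) (R : list T) : Prop :=
  2 <= k /\
  fset_ok R /\
  (forall i, i < k -> fset_ok (Ds i)) /\
  (forall i, i < k -> length (Ds i) = length (Ds 0)) /\
  (forall i j, i < k -> j < k -> i <> j ->
     forall x, (In x (Ds i) /\ In x (Ds j)) <-> In x R) /\
  (forall i, i < k ->
     set_lt (fun x => In x R) (fun y => In y (Ds i) /\ ~ In y R)) /\
  (forall i j, i < j -> j < k ->
     set_lt (fun x => In x (Ds i) /\ ~ In x R)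
            (fun y => In y (Ds j) /\ ~ In y R)).

(* A type <m_k, n_{k+1}, r_{k+1}>: m k = m_k, n k = n_k, r k = r_k (k >= 1);
   the values n 0, r 0 are irrelevant. *)
Definition is_type (m n r : nat -> nat) : Prop :=
  m 0 = 1 /\
  forall k, 2 <= n (S k) /\ r (S k) < m k /\
            m (S k) = r (S k) + (m k - r (S k)) * n (S k).

Definition good_type (m n r : nat -> nat) : Prop :=
  is_type m n r /\ forall rr N, exists k, N < k /\ r k = rr.

Section Scheme.
Context (m n r : nat -> nat) (FF : list T -> Prop).

Definition decomp (F : list T) (l : nat) (Fs : nat -> list T) (R : list T) : Prop :=
  (forall i, i < n l -> FF (Fs i) /\ length (Fs i) = m (pred l)) /\
  (forall x, In x F <-> exists i, i < n l /\ In x (Fs i)) /\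
  length R = r l /\
  rtt_delta Fs (n l) R.

Definition initial_seg_inter (E F : list T) : Prop :=
  forall x y, In x E -> In x F -> In y E -> ltT y x -> In y F.

Definition is_scheme : Prop :=
  (forall F, FF F -> F <> [] /\ fset_ok F /\ exists k, length F = m k) /\
  (forall A : list T, exists F, FF F /\ forall x, In x A -> In x F) /\
  (forall k E F, FF E -> FF F -> length E = m k -> length F = m k ->
     initial_seg_inter E F /\ initial_seg_inter F E) /\
  (forall k F, FF F -> length F = m (S k) ->
     exists Fs R, decomp F (S k) Fs R).

Definition rho_le (x a : T) (k : nat) : Prop :=
  exists j, j <= k /\ exists F, FF F /\ length F = m j /\ In x F /\ In a F.

Definition norm_is (a : T) (k N : nat) : Prop :=
  exists L, NoDup L /\ length L = N /\
    forall x, In x L <-> (ltT x a /\ rho_le x a k).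

Definition same_norm (a b : T) (k : nat) : Prop :=
  exists N, norm_is a k N /\ norm_is b k N.

Definition Delta_eq (a b : T) (l : nat) : Prop :=
  (forall k, k < l -> same_norm a b k) /\ ~ same_norm a b l.

(* Xi_a(l) = v  (l >= 1), read off any F in F_l containing a *)
Definition Xi_is (a : T) (l : nat) (v : Z) : Prop :=
  exists F, FF F /\ length F = m l /\ In a F /\
    exists Fs R, decomp F l Fs R /\
      ((In a R /\ v = (-1)%Z) \/
       (exists i, i < n l /\ In a (Fs i) /\ ~ In a R /\ v = Z.of_nat i)).

Definition Delta_captured (Ds : nat -> list T) (k l : nat) : Prop :=
  1 <= l /\ k <= n l /\
  exists R, rtt_delta Ds k R /\
    (forall i a x, i < k -> nth_error (Ds i) a = Some x ->
       (a < length R -> Xi_is x l (-1)%Z) /\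
       (length R <= a -> Xi_is x l (Z.of_nat i))) /\
    (forall i j a x y, i < j -> j < k -> length R <= a ->
       nth_error (Ds i) a = Some x -> nth_error (Ds j) a = Some y ->
       Delta_eq x y l).

Definition n_Delta_capturing (k : nat) : Prop :=
  forall S : list T -> Prop,
    (forall D, S D -> D <> [] /\ fset_ok D) ->
    uncountable_family S ->
    forall N, exists l, N < l /\
      exists Ds : nat -> list T,
        (forall i, i < k -> S (Ds i)) /\
        (forall i j, i < k -> j < k -> i <> j -> Ds i <> Ds j) /\
        Delta_captured Ds k l.

Definition Delta_capturing : Prop :=
  forall k, 2 <= k -> n_Delta_capturing k.

End Scheme.

Definition CA_Delta : Prop :=
  (forall k (m n r : nat -> nat), 2 <= k -> good_type m n r ->
     (forall j, 1 <= j -> k <= n j) ->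
     exists FF, is_scheme m n r FF /\ n_Delta_capturing m n r FF k) /\
  (forall (m n r : nat -> nat), good_type m n r ->
     (forall j, n (S j) <= n (S (S j))) ->
     (forall B, exists j, B < n (S j)) ->
     exists FF, is_scheme m n r FF /\ Delta_capturing m n r FF).

Definition is_metric (d : T -> T -> R) : Prop :=
  (forall x y, (0 <= d x y)%R) /\
  (forall x y, d x y = 0%R <-> x = y) /\
  (forall x y, d x y = d y x) /\
  (forall x y z, (d x z <= d x y + d y z)%R).

Definition strict_linear_order_on (Y : T -> Prop) (p : T -> T -> Prop) : Prop :=
  (forall x, Y x -> ~ p x x) /\
  (forall x y z, Y x -> Y y -> Y z -> p x y -> p y z -> p x z) /\
  (forall x y, Y x -> Y y -> x <> y -> p x y \/ p y x).

Definition c_monotone (d : T -> T -> R) (Y : T -> Prop) (c : R) : Prop :=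
  exists p, strict_linear_order_on Y p /\
    forall x y z, Y x -> Y y -> Y z -> p x y -> p y z ->
      (d x y <= c * d x z)%R.

Definition monotone (d : T -> T -> R) (Y : T -> Prop) : Prop :=
  exists c, (0 < c)%R /\ c_monotone d Y c.

End CA.

(* Main.v *)
(** Reading off the values [Xi_a(l)] turns the points of a construction scheme
    into branches of a finitely branching tree, and [Delta(a,b)] is the level at
    which two branches split.  Put a metric [tripod] on the children of a node,
    the path metric of three half-lines glued near their origins, and let
    [d(a,b)] be the [tripod]-distance of the two children at the splitting level
    [l], scaled by [1/(l+1)!].  The branching [n_l = l+1] is slow enough for
    this to be a metric.  Capturing singletons, every uncountable set contains
    rescaled copies of arbitrarily long finite tripods.  These are not
    [c]-monotone: the end of the leg that is middle in the order lies between
    the two other ends, yet these are joined by a path of short steps staying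
    far away from it, and some step of this path jumps over the middle end. *)

Require Import Defs.
From Stdlib Require Import Reals List.
From Stdlib Require Import Arith Lia Lra ZArith Sorted Cantor.
From Stdlib Require Import Classical ClassicalEpsilon.
Import ListNotations.

(** * Finite lists *)

Lemma StronglySorted_NoDup {A : Type} (lt : A -> A -> Prop) (l : list A) :
  (forall x, ~ lt x x) -> StronglySorted lt l -> NoDup l.
Proof.
  intros irr; induction l as [|x l IH]; intros Hs; constructor;
    apply StronglySorted_inv in Hs; destruct Hs as [Hs Hx].
  - intros Hin. rewrite Forall_forall in Hx. exact (irr x (Hx x Hin)).
  - now apply IH.
Qed.

Lemma NoDup_same_length {A : Type} (l1 l2 : list A) :
  NoDup l1 -> NoDup l2 -> (forall x, In x l1 <-> In x l2) ->
  length l1 = length l2.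
Proof.
  intros H1 H2 H; apply Nat.le_antisymm; apply NoDup_incl_length; auto;
    intros x; apply H.
Qed.

Lemma list_separation {A : Type} (P : A -> Prop) (l : list A) :
  NoDup l -> exists l', NoDup l' /\ forall x, In x l' <-> In x l /\ P x.
Proof.
  intros Hl.
  set (f := fun x => if excluded_middle_informative (P x) then true else false).
  exists (filter f l); split.
  - now apply NoDup_filter.
  - intros x; rewrite filter_In; unfold f.
    destruct (excluded_middle_informative (P x)); intuition discriminate.
Qed.

Lemma list_difference {A : Type} (l r : list A) :
  NoDup l -> NoDup r -> incl r l ->
  exists l', NoDup l' /\ length l' = length l - length r /\
    forall x, In x l' <-> In x l /\ ~ In x r.
Proof.
  intros Hl Hr Hrl.
  destruct (list_separation (fun x => ~ In x r) l Hl) as [l' [Hl' Hin]].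
  exists l'; repeat split; auto; try apply Hin; auto.
  enough (length (l' ++ r) = length l) by (rewrite length_app in *; lia).
  apply NoDup_same_length; auto.
  - apply NoDup_app; auto. intros x Hx; apply Hin in Hx; tauto.
  - intros x; rewrite in_app_iff, Hin. specialize (Hrl x).
    destruct (classic (In x r)); tauto.
Qed.

Lemma uncountable_fresh {T : Type} (l : list T) :
  uncountable_set (fun _ : T => True) -> exists x, ~ In x l.
Proof.
  intros Hunc; apply NNPP; intros Hno; apply Hunc.
  assert (Hall : forall x, exists k, nth_error l k = Some x).
  { intros x; apply In_nth_error, NNPP; intros Hx; apply Hno; now exists x. }
  exists (fun x => proj1_sig (constructive_indefinite_description _ (Hall x))).
  intros x y _ _.
  destruct (constructive_indefinite_description _ (Hall x)) as [i Hi].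
  destruct (constructive_indefinite_description _ (Hall y)) as [j Hj].
  simpl; congruence.
Qed.

Lemma uncountable_long_list {T : Type} (k : nat) :
  uncountable_set (fun _ : T => True) ->
  exists l : list T, NoDup l /\ length l = k.
Proof.
  intros Hunc; induction k as [|k [l [Hl Hk]]].
  - exists []; split; [constructor | reflexivity].
  - destruct (uncountable_fresh l Hunc) as [x Hx].
    exists (x :: l); split; [now constructor | simpl; lia].
Qed.

(** * Norms in a construction scheme *)

Section Scheme.

Context {T : Type} (ltT : T -> T -> Prop) (m n r : nat -> nat)
  (FF : list T -> Prop).
Hypothesis (Homega1 : is_omega1 ltT) (Htype : is_type m n r)
  (Hscheme : is_scheme ltT m n r FF).

Lemma lt_irrefl x : ~ ltT x x.
Proof. apply Homega1. Qed.

Lemma lt_trans x y z : ltT x y -> ltT y z -> ltT x z.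
Proof. apply Homega1. Qed.

Lemma fset_NoDup D : fset_ok ltT D -> NoDup D.
Proof. apply StronglySorted_NoDup, lt_irrefl. Qed.

Lemma m_lt_succ k : m k < m (S k).
Proof. destruct Htype as [_ H]; destruct (H k) as [H1 [H2 H3]]; nia. Qed.

Lemma m_mono j k : j <= k -> m j <= m k.
Proof.
  induction 1 as [|k _ IH]; [lia|]. pose proof (m_lt_succ k); lia.
Qed.

Lemma decomp_incl F l Fs R i x :
  decomp ltT m n r FF F l Fs R -> i < n l -> In x (Fs i) -> In x F.
Proof. intros [_ [H _]] Hi Hx; apply H; eauto. Qed.

Lemma decomp_root_incl F l Fs R i x :
  decomp ltT m n r FF F l Fs R -> i < n l -> In x R -> In x (Fs i).
Proof.
  intros [_ [_ [_ [H2 [_ [_ [_ [H _]]]]]]]] Hi Hx.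
  destruct (Nat.eq_dec i 0) as [->|Hi0].
  - now apply (H 0 1 ltac:(lia) ltac:(lia) ltac:(lia) x).
  - now apply (H i 0 ltac:(lia) ltac:(lia) ltac:(lia) x).
Qed.

Lemma member_below F k j a :
  FF F -> length F = m k -> j <= k -> In a F ->
  exists F', FF F' /\ length F' = m j /\ In a F' /\ incl F' F.
Proof.
  intros HF HFk Hjk; revert F HF HFk.
  induction Hjk as [|k Hjk IH]; intros F HF HFk Ha.
  - exists F; repeat split; auto. apply incl_refl.
  - destruct Hscheme as [_ [_ [_ Hdec]]].
    destruct (Hdec k F HF HFk) as [Fs [R HD]].
    pose proof HD as [HFs [Hcov _]].
    apply Hcov in Ha; destruct Ha as [i [Hi Ha]].
    destruct (HFs i Hi) as [Hi1 Hi2].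
    destruct (IH (Fs i) Hi1 Hi2 Ha) as [F' [H1 [H2 [H3 H4]]]].
    exists F'; repeat split; auto.
    intros x Hx; eapply decomp_incl; eauto.
Qed.

(** Cofinality, applied to [a] and [m k] distinct points, yields a member of size at least [m k];
    since [m] is strictly increasing its level is at least [k], and [member_below] descends from
    there. *)
Lemma member_at_level a k : exists F, FF F /\ length F = m k /\ In a F.
Proof.
  destruct Homega1 as [_ [_ [_ [_ [Hunc _]]]]].
  destruct (uncountable_long_list (T := T) (m k) Hunc) as [A [HA HAk]].
  pose proof Hscheme as [Hok [Hcof _]].
  destruct (Hcof (a :: A)) as [F [HF Hin]].
  destruct (Hok F HF) as [_ [_ [j Hj]]].
  assert (Hle : m k <= m j).
  { rewrite <- HAk, <- Hj. apply NoDup_incl_length; auto.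
    intros x Hx; apply Hin; now right. }
  destruct (Nat.le_gt_cases k j) as [Hkj|Hkj].
  - destruct (member_below F j k a HF Hj Hkj (Hin a (or_introl eq_refl)))
      as [F' [H1 [H2 [H3 _]]]]; eauto.
  - exfalso. pose proof (m_mono (S j) k Hkj). pose proof (m_lt_succ j); lia.
Qed.

(** A witness [E] of level [j] and a level-[j] piece of [F] around [a] meet in an initial segment,
    so the points of [E] below [a] already lie in [F]. Norms can thus be counted inside any one
    member. *)
Lemma rho_le_member F a k x :
  FF F -> length F = m k -> In a F -> ltT x a ->
  (rho_le m FF x a k <-> In x F).
Proof.
  intros HF HFk Ha Hxa; split.
  - intros [j [Hjk [E [HE [HEj [Hx HaE]]]]]].
    destruct (member_below F k j a HF HFk Hjk Ha) as [F' [H1 [H2 [H3 H4]]]].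
    apply H4. pose proof Hscheme as [_ [_ [Hinit _]]].
    destruct (Hinit j E F' HE H1 HEj H2) as [Hi _]. now apply (Hi a x).
  - intros Hx; exists k; split; auto; exists F; auto.
Qed.

Lemma norm_unique a k N1 N2 :
  norm_is ltT m FF a k N1 -> norm_is ltT m FF a k N2 -> N1 = N2.
Proof.
  intros [L1 [H1 [<- H1']]] [L2 [H2 [<- H2']]].
  apply NoDup_same_length; auto. intros x; rewrite H1', H2'; tauto.
Qed.

Lemma norm_exists a k : exists N, norm_is ltT m FF a k N.
Proof.
  destruct (member_at_level a k) as [F [HF [HFk Ha]]].
  pose proof Hscheme as [Hok _].
  destruct (Hok F HF) as [_ [HFok _]].
  destruct (list_separation (fun x => ltT x a) F (fset_NoDup F HFok))
    as [L [HL HLin]].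
  exists (length L), L; repeat split; auto.
  - apply HLin in H; tauto.
  - apply HLin in H; destruct H; now apply (rho_le_member F).
  - intros [H1 H2]; apply HLin; split; auto.
    now apply (rho_le_member F a k x).
Qed.

Definition norm (a : T) (k : nat) : nat :=
  proj1_sig (constructive_indefinite_description _ (norm_exists a k)).

Lemma normP a k : norm_is ltT m FF a k (norm a k).
Proof. exact (proj2_sig (constructive_indefinite_description _ _)). Qed.

Lemma norm_eq a k N : norm_is ltT m FF a k N -> norm a k = N.
Proof. apply norm_unique, normP. Qed.

Lemma same_norm_iff a b k :
  same_norm ltT m FF a b k <-> norm a k = norm b k.
Proof.
  split.
  - intros [N [H1 H2]]; rewrite (norm_eq _ _ _ H1), (norm_eq _ _ _ H2); auto.
  - intros H; exists (norm a k); split; [|rewrite H]; apply normP.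
Qed.

(** At the level of a member containing both points, [x] and all predecessors counted for [x] are
    counted for [y]. *)
Lemma norm_lt_separates x y : ltT x y -> exists k, norm x k <> norm y k.
Proof.
  intros Hxy. pose proof Hscheme as [Hok [Hcof _]].
  destruct (Hcof [x; y]) as [F [HF Hin]].
  destruct (Hok F HF) as [_ [_ [k HFk]]].
  assert (HxF : In x F) by (apply Hin; simpl; auto).
  assert (HyF : In y F) by (apply Hin; simpl; auto).
  exists k.
  destruct (normP x k) as [Lx [Hx [Hxn HxL]]].
  destruct (normP y k) as [Ly [Hy [Hyn HyL]]].
  rewrite <- Hxn, <- Hyn.
  enough (length (x :: Lx) <= length Ly) by (simpl in *; lia).
  apply NoDup_incl_length.
  - constructor; auto. rewrite HxL. intros [H _]; exact (lt_irrefl x H).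
  - intros z [<-|Hz]; apply HyL.
    + split; auto. now apply (rho_le_member F).
    + apply HxL in Hz; destruct Hz as [Hzx Hz].
      assert (ltT z y) by (eapply lt_trans; eauto).
      split; auto. apply (rho_le_member F); auto.
      now apply (rho_le_member F x k z) in Hz.
Qed.

Lemma norm_separates x y : x <> y -> exists k, norm x k <> norm y k.
Proof.
  intros Hne. destruct Homega1 as [_ [_ [Htot _]]].
  destruct (Htot x y Hne) as [H|H]; destruct (norm_lt_separates _ _ H) as [k Hk];
    exists k; auto.
Qed.

Lemma decomp_tails F l Fs R i :
  decomp ltT m n r FF F l Fs R -> i <= n l ->
  exists K, NoDup K /\ length K = (m (pred l) - r l) * i /\
    forall x, In x K <-> exists j, j < i /\ In x (Fs j) /\ ~ In x R.
Proof.
  intros HD; induction i as [|i IH]; intros Hi.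
  - exists []; repeat split; [constructor | simpl; lia | intros [] |].
    intros [j [Hj _]]; lia.
  - destruct IH as [K [HK [HKl HKin]]]; [lia|].
    pose proof HD as [HFs [_ [HRl [_ [HR [HFsok [_ [Hint _]]]]]]]].
    destruct (list_difference (Fs i) R) as [K' [HK' [HKl' HKin']]].
    + apply fset_NoDup, HFsok; lia.
    + now apply fset_NoDup.
    + intros x; eapply decomp_root_incl; eauto.
    + exists (K ++ K'); repeat split.
      * apply NoDup_app; auto. intros x Hx Hx'.
        apply HKin in Hx; apply HKin' in Hx'.
        destruct Hx as [j [Hj [Hxj HxR]]]. apply HxR.
        apply (Hint j i ltac:(lia) ltac:(lia) ltac:(lia)); tauto.
      * rewrite length_app, HKl, HKl', HRl.
        destruct (HFs i ltac:(lia)) as [_ ->]. lia.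
      * intros Hx; apply in_app_iff in Hx; destruct Hx as [Hx|Hx].
        -- apply HKin in Hx; destruct Hx as [j [Hj Hx]]; exists j; split; auto.
        -- apply HKin' in Hx; exists i; split; auto.
      * intros [j [Hj Hx]]; apply in_app_iff.
        destruct (Nat.eq_dec j i) as [->|Hji].
        -- right; now apply HKin'.
        -- left; apply HKin; exists j; split; auto; lia.
Qed.

(* An element of the root is treated as lying in [Fs 0]. *)
Lemma norm_step F l Fs R i a :
  FF F -> length F = m l -> decomp ltT m n r FF F l Fs R ->
  i < n l -> In a (Fs i) -> (~ In a R \/ i = 0) ->
  norm a l = norm a (pred l) + (m (pred l) - r l) * i.
Proof.
  intros HF HFl HD Hi Ha Hroot.
  destruct (decomp_tails F l Fs R i HD ltac:(lia)) as [K [HK [HKl HKin]]].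
  destruct (normP a (pred l)) as [L [HL [HLl HLin]]].
  pose proof HD as [HFs [Hcov [HRl [_ [HR [HFsok [_ [Hint [Hlow Htail]]]]]]]]].
  destruct (HFs i Hi) as [HFi HFil].
  assert (HaF : In a F) by (eapply decomp_incl; eauto).
  assert (HL' : forall x, In x L <-> ltT x a /\ In x (Fs i)).
  { intros x; rewrite HLin.
    split; intros [H1 H2]; split; auto;
      now apply (rho_le_member (Fs i) a (pred l) x). }
  (* The predecessors of [a] in [F] are those in its own piece, listed in [L], and the tails of all
     earlier pieces, listed in [K]. *)
  apply norm_eq. exists (L ++ K). split; [|split].
  - apply NoDup_app; auto. intros x Hx HxK.
    apply HL' in Hx; apply HKin in HxK.
    destruct HxK as [j [Hj [Hxj HxR]]]; apply HxR.
    apply (Hint j i ltac:(lia) ltac:(lia) ltac:(lia)); tauto.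
  - rewrite length_app; lia.
  - intros x; rewrite in_app_iff, HL', HKin.
    assert (Hrho : ltT x a -> (rho_le m FF x a l <-> In x F))
      by (intros; now apply rho_le_member).
    split.
    + intros [[Hx1 Hx2]|[j [Hj [Hxj HxR]]]].
      * split; auto. apply Hrho; auto. eapply decomp_incl; eauto.
      * assert (Hxa : ltT x a).
        { destruct Hroot as [HaR| ->]; [|lia].
          apply (Htail j i Hj Hi); auto. }
        split; auto. apply Hrho; auto. eapply decomp_incl; [eauto| |eauto]; lia.
    + intros [Hxa Hx]. apply Hrho in Hx; auto.
      apply Hcov in Hx; destruct Hx as [j [Hj Hx]].
      destruct (classic (In x R)) as [HxR|HxR].
      { left; split; auto. eapply decomp_root_incl; eauto. }
      destruct (Nat.lt_trichotomy j i) as [Hji|[->|Hji]]; eauto.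
      (* A tail point [x] of a later piece lies above [a], whether [a] is in the root or in an
         earlier tail. *)
      exfalso. apply (lt_irrefl x), (lt_trans _ a); auto.
      destruct (classic (In a R)) as [HaR|HaR].
      * now apply (Hlow j Hj).
      * now apply (Htail i j Hji Hj).
Qed.

(** * The branch of a point *)

(* [max (Xi_a(l)) 0], recovered from the norms; it is [0] at [l = 0]. *)
Definition branch (a : T) (l : nat) : nat :=
  (norm a l - norm a (pred l)) / (m (pred l) - r l).

Lemma branch_step a l i :
  1 <= l -> norm a l = norm a (pred l) + (m (pred l) - r l) * i ->
  branch a l = i.
Proof.
  intros Hl H; unfold branch; rewrite H.
  destruct Htype as [_ Ht]; destruct l as [|l]; [lia|].
  destruct (Ht l) as [_ [Hr _]]; simpl pred.
  rewrite Nat.add_comm, Nat.add_sub, Nat.mul_comm.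
  apply Nat.div_mul; lia.
Qed.

Lemma branch_spec a l :
  1 <= l -> branch a l < n l /\
    norm a l = norm a (pred l) + (m (pred l) - r l) * branch a l.
Proof.
  intros Hl.
  enough (exists i, i < n l /\
    norm a l = norm a (pred l) + (m (pred l) - r l) * i) as [i [Hi H]].
  { rewrite (branch_step a l i Hl H); auto. }
  destruct l as [|l]; [lia|].
  destruct (member_at_level a (S l)) as [F [HF [HFl Ha]]].
  pose proof Hscheme as [_ [_ [_ Hdec]]].
  destruct (Hdec l F HF HFl) as [Fs [R HD]].
  pose proof HD as [_ [Hcov _]].
  destruct (proj1 (Hcov a) Ha) as [i [Hi Hai]].
  destruct (classic (In a R)) as [HaR|HaR].
  - exists 0; split; [lia|]. eapply norm_step; eauto; [lia|].
    eapply decomp_root_incl; eauto; lia.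
  - exists i; split; auto. eapply norm_step; eauto.
Qed.

Lemma branch_Xi a l i :
  1 <= l -> Xi_is ltT m n r FF a l (Z.of_nat i) -> branch a l = i.
Proof.
  intros Hl [F [HF [HFl [Ha [Fs [R [HD [[_ H]|[j [Hj [Haj [HaR H]]]]]]]]]]]];
    [lia|].
  apply Nat2Z.inj in H; subst j.
  apply branch_step; auto. eapply norm_step; eauto.
Qed.

(** By [branch_spec] the branch determines every norm by recursion from [norm a 0 = 0], and norms
    separate points. *)
Lemma branch_separates x y : x <> y -> exists l, branch x l <> branch y l.
Proof.
  intros Hne. apply NNPP; intros Hno.
  assert (Heq : forall l, branch x l = branch y l).
  { intros l; apply NNPP; intros H; apply Hno; eauto. }
  destruct (norm_separates x y Hne) as [k Hk]. apply Hk; clear Hk.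
  (* Members of level 0 are singletons because [m 0 = 1]. *)
  assert (norm0 : forall a, norm a 0 = 0).
  { intros a. destruct (normP a 0) as [L [HL [HLl HLin]]].
    destruct L as [|z L]; [now rewrite <- HLl|exfalso].
    destruct (proj1 (HLin z) (or_introl eq_refl)) as [Hza Hz].
    destruct (member_at_level a 0) as [F [HF [HFl Ha]]].
    apply (rho_le_member F) in Hz; auto.
    destruct Htype as [Hm0 _]; rewrite Hm0 in HFl.
    destruct F as [|w [|]]; try discriminate HFl.
    destruct Ha as [->|[]]; destruct Hz as [->|[]].
    exact (lt_irrefl z Hza). }
  induction k as [|k IH]; [now rewrite !norm0|].
  rewrite (proj2 (branch_spec x (S k) ltac:(lia))).
  rewrite (proj2 (branch_spec y (S k) ltac:(lia))).
  simpl pred; rewrite Heq, IH; reflexivity.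
Qed.

Lemma branch_Delta x y l k :
  Delta_eq ltT m FF x y l -> k < l -> branch x k = branch y k.
Proof.
  intros [H _] Hk; unfold branch.
  rewrite (proj1 (same_norm_iff x y k)), (proj1 (same_norm_iff x y (pred k)));
    auto; apply H; lia.
Qed.

End Scheme.

(** * The tripod *)

(* The number [3q + a] codes the point at distance [q + 1] from the centre on
   leg [a]; the centre itself is not a point. *)
Definition tripod (i j : nat) : nat :=
  if i mod 3 =? j mod 3 then (i / 3 - j / 3) + (j / 3 - i / 3)
  else i / 3 + j / 3 + 2.

Ltac tripod_cases :=
  unfold tripod;
  repeat match goal with |- context [Nat.eqb ?a ?b] =>
    destruct (Nat.eqb_spec a b) end; try lia.

Lemma tripod_refl i : tripod i i = 0.
Proof. tripod_cases. Qed.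

Lemma tripod_sym i j : tripod i j = tripod j i.
Proof. tripod_cases. Qed.

Lemma tripod_triangle i j k : tripod i k <= tripod i j + tripod j k.
Proof. tripod_cases. Qed.

Lemma tripod_pos i j : i <> j -> 1 <= tripod i j.
Proof.
  pose proof (Nat.div_mod_eq i 3); pose proof (Nat.div_mod_eq j 3).
  tripod_cases.
Qed.

(** The factor [S l] is what the last factor of [(l+1)!] cancels in [tree_dist_le]. *)
Lemma tripod_le i j l : i <= l -> j <= l -> tripod i j <= 2 * S l.
Proof.
  pose proof (Nat.Div0.div_le_upper_bound i 3 i ltac:(lia)).
  pose proof (Nat.Div0.div_le_upper_bound j 3 j ltac:(lia)).
  tripod_cases.
Qed.

Lemma tripod_legs p q a b :
  a < 3 -> b < 3 -> tripod (3 * p + a) (3 * q + b) =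
    if a =? b then (p - q) + (q - p) else p + q + 2.
Proof.
  intros Ha Hb; unfold tripod.
  assert (E : forall s c, c < 3 -> (3 * s + c) mod 3 = c /\ (3 * s + c) / 3 = s).
  { intros s c Hc; split.
    - symmetry; now apply (Nat.mod_unique _ _ s).
    - symmetry; now apply (Nat.div_unique _ _ s c). }
  destruct (E p a Ha) as [-> ->], (E q b Hb) as [-> ->]; reflexivity.
Qed.

Local Open Scope R_scope.

(** * Long tripods are not [c]-monotone *)

Section TripodNotMonotone.

Context {T : Type} (d : T -> T -> R) (Y : T -> Prop) (p : T -> T -> Prop)
  (c w : R) (M : nat) (f : nat -> T).
Hypothesis (Hd : is_metric d) (Hp : strict_linear_order_on Y p)
  (Hmono : forall x y z, Y x -> Y y -> Y z -> p x y -> p y z ->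
     d x y <= c * d x z)
  (Hc : 0 < c) (HM : 2 * c < INR M) (Hw : 0 < w)
  (HfY : forall i, (i < 3 * S M)%nat -> Y (f i))
  (Hfd : forall i j, (i < 3 * S M)%nat -> (j < 3 * S M)%nat -> i <> j ->
     d (f i) (f j) = w * INR (tripod i j)).

Lemma tripod_ends_neq a b :
  (a < 3)%nat -> (b < 3)%nat -> a <> b -> f (3 * M + a) <> f (3 * M + b).
Proof.
  intros Ha Hb Hab H.
  assert (H0 : d (f (3 * M + a)) (f (3 * M + b)) = 0) by now apply Hd.
  rewrite Hfd in H0 by lia.
  pose proof (tripod_pos (3 * M + a) (3 * M + b) ltac:(lia)) as Hpos.
  apply le_INR in Hpos; simpl (INR 1) in Hpos. nra.
Qed.

(** The end [3 * M + b] of leg [b] is more than [w * M], hence more than [2 * c * w], away from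
    every point of another leg. If a step of length at most [2 * w] jumped over it, monotonicity
    would bound that distance by [2 * c * w]. *)
Lemma tripod_step a b q a' q' :
  (a < 3)%nat -> (b < 3)%nat -> (a' < 3)%nat -> a <> b -> a' <> b ->
  (q <= M)%nat -> (q' <= M)%nat -> (3 * q + a <> 3 * q' + a')%nat ->
  (tripod (3 * q + a) (3 * q' + a') <= 2)%nat ->
  p (f (3 * q + a)) (f (3 * M + b)) -> p (f (3 * q' + a')) (f (3 * M + b)).
Proof.
  intros Ha Hb Ha' Hab Hab' Hq Hq' Hne Hstep Hlt.
  destruct Hp as [_ [_ Htot]].
  assert (far : forall s e, (s <= M)%nat -> (e < 3)%nat -> e <> b ->
    w * INR M < d (f (3 * s + e)) (f (3 * M + b))).
  { intros s e Hs He Heb. rewrite Hfd by lia.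
    rewrite tripod_legs by auto. destruct (Nat.eqb_spec e b); [lia|].
    apply Rmult_lt_compat_l; auto. apply lt_INR; lia. }
  destruct (Htot (f (3 * q' + a')) (f (3 * M + b))) as [H|H]; auto.
  - apply HfY; lia.
  - apply HfY; lia.
  - intros He. pose proof (far q' a' Hq' Ha' Hab') as Hf.
    apply (proj1 (proj2 Hd)) in He. rewrite He in Hf.
    pose proof (pos_INR M). nra.
  - exfalso.
    pose proof (Hmono _ _ _ (HfY (3 * q + a) ltac:(lia))
      (HfY (3 * M + b) ltac:(lia)) (HfY (3 * q' + a') ltac:(lia)) Hlt H) as Hm.
    pose proof (far q a Hq Ha Hab) as Hf.
    rewrite (Hfd (3 * q + a) (3 * q' + a')) in Hm by lia.
    apply le_INR in Hstep; simpl (INR 2) in Hstep.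
    assert (c * (w * INR (tripod (3 * q + a) (3 * q' + a'))) <= c * (w * 2)).
    { apply Rmult_le_compat_l; [lra|]. apply Rmult_le_compat_l; lra. }
    nra.
Qed.

Lemma tripod_ends_not_between a b e :
  (a < 3)%nat -> (b < 3)%nat -> (e < 3)%nat -> a <> b -> b <> e -> a <> e ->
  p (f (3 * M + a)) (f (3 * M + b)) -> p (f (3 * M + b)) (f (3 * M + e)) ->
  False.
Proof.
  intros Ha Hb He Hab Hbe Hae H1 H2.
  (* The path runs inward along leg [a] and then outward along leg [e], staying before the end of
     leg [b]; this contradicts the position of the end of leg [e]. *)
  assert (down : forall s, (s <= M)%nat ->
    p (f (3 * (M - s) + a)) (f (3 * M + b))).
  { induction s as [|s IH]; intros Hs; [now rewrite Nat.sub_0_r|].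
    apply (tripod_step a b (M - s)); try lia.
    - rewrite tripod_legs, Nat.eqb_refl by auto; lia.
    - apply IH; lia. }
  assert (up : forall s, (s <= M)%nat -> p (f (3 * s + e)) (f (3 * M + b))).
  { induction s as [|s IH]; intros Hs.
    (* The innermost points of two legs are at distance 2, the largest step of the path. *)
    - apply (tripod_step a b 0); try lia.
      + rewrite tripod_legs by auto. destruct (Nat.eqb_spec a e); lia.
      + pose proof (down M (le_n M)) as H; now rewrite Nat.sub_diag in H.
    - apply (tripod_step e b s); try lia.
      + rewrite tripod_legs, Nat.eqb_refl by auto; lia.
      + apply IH; lia. }
  destruct Hp as [Hirr [Htr _]].
  apply (Hirr (f (3 * M + b))); [apply HfY; lia|].
  apply (Htr _ (f (3 * M + e))); auto; apply HfY; lia.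
Qed.

Lemma tripod_not_monotone : False.
Proof.
  destruct Hp as [_ [_ Htot]].
  assert (cmp : forall a b, (a < 3)%nat -> (b < 3)%nat -> a <> b ->
    p (f (3 * M + a)) (f (3 * M + b)) \/ p (f (3 * M + b)) (f (3 * M + a))).
  { intros a b Ha Hb Hab; apply Htot; [apply HfY; lia..|].
    now apply tripod_ends_neq. }
  pose proof tripod_ends_not_between as nb.
  (* Each of the eight orientations of the three pairs, even a cyclic one, contains a chain through
     all three ends. *)
  destruct (cmp 0 1 ltac:(lia) ltac:(lia) ltac:(lia))%nat as [H01|H01];
  destruct (cmp 0 2 ltac:(lia) ltac:(lia) ltac:(lia))%nat as [H02|H02];
  destruct (cmp 1 2 ltac:(lia) ltac:(lia) ltac:(lia))%nat as [H12|H12].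
  - apply (nb 0 1 2)%nat; auto; lia.
  - apply (nb 0 2 1)%nat; auto; lia.
  - apply (nb 2 0 1)%nat; auto; lia.
  - apply (nb 2 0 1)%nat; auto; lia.
  - apply (nb 1 0 2)%nat; auto; lia.
  - apply (nb 1 0 2)%nat; auto; lia.
  - apply (nb 1 2 0)%nat; auto; lia.
  - apply (nb 2 1 0)%nat; auto; lia.
Qed.

End TripodNotMonotone.

(** * The metric of a tree of branches *)

Section TreeMetric.

Context {T : Type} (G : T -> nat -> nat).
Hypothesis (Gsep : forall x y, x <> y -> exists l, G x l <> G y l)
  (Gle : forall x l, (G x l <= l)%nat).

Definition splits (x y : T) (l : nat) : Prop :=
  (forall k, (k < l)%nat -> G x k = G y k) /\ G x l <> G y l.

Lemma splits_exists x y : x <> y -> exists l, splits x y l.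
Proof.
  intros Hne; destruct (Gsep x y Hne) as [l Hl].
  destruct (dec_inh_nat_subset_has_unique_least_element
    (fun l => G x l <> G y l)) as [l0 [[H1 H2] _]]; eauto.
  - intros k; destruct (Nat.eq_dec (G x k) (G y k)); auto.
  - exists l0; split; auto. intros k Hk; apply NNPP; intros H.
    specialize (H2 k H); lia.
Qed.

Lemma splits_unique x y l l' : splits x y l -> splits x y l' -> l = l'.
Proof.
  intros [H1 H2] [H1' H2'].
  destruct (Nat.lt_trichotomy l l') as [H|[H|H]]; auto.
  - now elim H2; apply H1'.
  - now elim H2'; apply H1.
Qed.

Lemma splits_sym x y l : splits x y l -> splits y x l.
Proof. intros [H1 H2]; split; auto; intros k Hk; symmetry; auto. Qed.

(* For [x = y] the level is arbitrary, but then [tripod] vanishes. *)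
Definition tree_dist (x y : T) : R :=
  let l := epsilon (inhabits 0%nat) (splits x y) in
  / INR (fact (S l)) * INR (tripod (G x l) (G y l)).

Lemma tree_dist_splits x y l :
  splits x y l ->
  tree_dist x y = / INR (fact (S l)) * INR (tripod (G x l) (G y l)).
Proof.
  intros H; unfold tree_dist.
  rewrite (splits_unique x y _ l (epsilon_spec _ _ (ex_intro _ l H)) H).
  reflexivity.
Qed.

Lemma inv_fact_pos l : 0 < / INR (fact l).
Proof. apply Rinv_0_lt_compat, INR_fact_lt_0. Qed.

Lemma tree_dist_refl x : tree_dist x x = 0.
Proof. unfold tree_dist; rewrite tripod_refl; simpl (INR 0); ring. Qed.

Lemma tree_dist_sym x y : tree_dist x y = tree_dist y x.
Proof.
  destruct (classic (x = y)) as [->|Hne]; auto.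
  destruct (splits_exists x y Hne) as [l Hl].
  rewrite (tree_dist_splits x y l Hl), (tree_dist_splits y x l (splits_sym _ _ _ Hl)).
  now rewrite tripod_sym.
Qed.

Lemma tree_dist_ge x y l : splits x y l -> / INR (fact (S l)) <= tree_dist x y.
Proof.
  intros Hl; rewrite (tree_dist_splits x y l Hl).
  pose proof (tripod_pos _ _ (proj2 Hl)) as H; apply le_INR in H.
  simpl (INR 1) in H. pose proof (inv_fact_pos (S l)). nra.
Qed.

(** The bound [2 * (l'+1) / (l'+1)! = 2 / l'!] is at most [2 / (l+1)!] as [l < l']. By
    [tree_dist_ge], two distances with splitting level [l] add up to at least as much. *)
Lemma tree_dist_le x y l l' :
  splits x y l' -> (l < l')%nat -> tree_dist x y <= 2 * / INR (fact (S l)).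
Proof.
  intros Hl Hll; rewrite (tree_dist_splits x y l' Hl).
  pose proof (tripod_le _ _ _ (Gle x l') (Gle y l')) as H; apply le_INR in H.
  rewrite mult_INR in H; simpl (INR 2) in H.
  apply Rle_trans with (/ INR (fact (S l')) * (2 * INR (S l'))).
  { apply Rmult_le_compat_l; auto. left; apply inv_fact_pos. }
  rewrite fact_simpl, mult_INR.
  replace (/ (INR (S l') * INR (fact l')) * (2 * INR (S l')))
    with (2 * / INR (fact l')).
  2: { field; split; [apply INR_fact_neq_0 | apply not_0_INR; lia]. }
  apply Rmult_le_compat_l; [lra|].
  apply Rinv_le_contravar; [apply INR_fact_lt_0|].
  apply le_INR, fact_le; lia.
Qed.

Lemma tree_dist_ge0 x y : 0 <= tree_dist x y.
Proof.
  unfold tree_dist; apply Rmult_le_pos; [left; apply inv_fact_pos | apply pos_INR].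
Qed.

(** The branches of [y] and [z] agree up to and including level [l], so [x] splits from both in the
    same way. *)
Lemma tree_dist_split_below x y z l l' :
  splits x y l -> splits y z l' -> (l < l')%nat ->
  tree_dist x z = tree_dist x y.
Proof.
  intros [H1 H2] [H1' H2'] Hl.
  assert (Hxz : splits x z l).
  { split.
    - intros k Hk; rewrite H1 by auto; apply H1'; lia.
    - rewrite <- (H1' l Hl); auto. }
  rewrite (tree_dist_splits x z l Hxz), (tree_dist_splits x y l (conj H1 H2)).
  now rewrite (H1' l Hl).
Qed.

Lemma tree_dist_triangle x y z : tree_dist x z <= tree_dist x y + tree_dist y z.
Proof.
  pose proof (tree_dist_ge0 x y) as Hxy0; pose proof (tree_dist_ge0 y z) as Hyz0.
  destruct (classic (x = y)) as [->|Hxy]; [rewrite tree_dist_refl; lra|].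
  destruct (classic (y = z)) as [->|Hyz]; [rewrite tree_dist_refl; lra|].
  destruct (classic (x = z)) as [->|Hxz]; [rewrite tree_dist_refl; lra|].
  destruct (splits_exists x y Hxy) as [l Hl].
  destruct (splits_exists y z Hyz) as [l' Hl'].
  destruct (Nat.lt_trichotomy l l') as [H|[H|H]].
  - rewrite (tree_dist_split_below x y z l l'); auto; lra.
  - subst l'. destruct (splits_exists x z Hxz) as [k Hk].
    destruct (Nat.lt_trichotomy k l) as [H|[H|H]].
    + exfalso; apply (proj2 Hk).
      rewrite (proj1 Hl k H); exact (proj1 Hl' k H).
    + subst k.
      rewrite (tree_dist_splits _ _ _ Hl), (tree_dist_splits _ _ _ Hl'),
        (tree_dist_splits _ _ _ Hk).
      rewrite <- Rmult_plus_distr_l, <- plus_INR.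
      apply Rmult_le_compat_l; [left; apply inv_fact_pos|].
      apply le_INR, tripod_triangle.
    (* Here [x] and [z] take the same child at level [l], different from that of [y], and split
       later: the case for which the scaling is chosen. *)
    + pose proof (tree_dist_le x z l k Hk H).
      pose proof (tree_dist_ge x y l Hl). pose proof (tree_dist_ge y z l Hl').
      lra.
  - rewrite (tree_dist_sym x z), (tree_dist_sym y z) in *.
    rewrite (tree_dist_split_below z y x l' l); auto using splits_sym. lra.
Qed.

Lemma tree_dist_metric : is_metric tree_dist.
Proof.
  split; [|split; [|split]].
  - apply tree_dist_ge0.
  - intros x y; split; [|intros ->; apply tree_dist_refl].
    intros H; apply NNPP; intros Hne.
    destruct (splits_exists x y Hne) as [l Hl].
    pose proof (tree_dist_ge x y l Hl). pose proof (inv_fact_pos (S l)). lra.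
  - apply tree_dist_sym.
  - apply tree_dist_triangle.
Qed.

End TreeMetric.

(** * A good type with [n_k = k + 1] *)

(** The first component of Cantor unpairing takes every value infinitely often; [pred] accounts for
    the indices starting at 1. *)
Definition type_r (k : nat) : nat := fst (Cantor.of_nat (pred k)).

Fixpoint type_m (k : nat) : nat :=
  match k with
  | O => 1
  | S j => type_r (S j) + (type_m j - type_r (S j)) * S (S j)
  end.

Lemma type_r_le k : (type_r (S k) <= k)%nat.
Proof.
  unfold type_r; simpl pred.
  destruct (Cantor.of_nat k) as [x y] eqn:E; simpl.
  pose proof (Cantor.to_nat_non_decreasing x y) as H.
  rewrite <- E, Cantor.cancel_to_of in H; lia.
Qed.

(** Together with [type_r_le] this gives the condition that [r_{k+1}] is below [m_k]. *)
Lemma type_m_gt k : (k < type_m k)%nat.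
Proof.
  induction k as [|k IH]; [simpl; lia|].
  pose proof (type_r_le k).
  change (S k < type_r (S k) + (type_m k - type_r (S k)) * S (S k))%nat. nia.
Qed.

Lemma type_good : good_type type_m S type_r.
Proof.
  split.
  - split; [reflexivity|]. intros k; split; [lia|split; [|reflexivity]].
    pose proof (type_r_le k); pose proof (type_m_gt k); lia.
  (* Pairing [rr] with [N] makes the code at least [N]. *)
  - intros rr N. exists (S (Cantor.to_nat (rr, N))); split.
    + pose proof (Cantor.to_nat_non_decreasing rr N); lia.
    + change (fst (Cantor.of_nat (Cantor.to_nat (rr, N))) = rr).
      now rewrite Cantor.cancel_of_to.
Qed.

(** * Scaled tripods in uncountable sets, by capturing singletons *)

Lemma singletons_uncountable {T : Type} (Y : T -> Prop) :
  uncountable_set Y -> uncountable_family (fun D => exists x, D = [x] /\ Y x).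
Proof.
  intros HY [g Hg]; apply HY; exists (fun x => g [x]).
  intros x y Hx Hy H.
  assert ([x] = [y]) by (apply Hg; eauto). congruence.
Qed.

Theorem mainTheorem15 (T : Type) (ltT : T -> T -> Prop) :
  is_omega1 ltT ->
  CA_Delta ltT ->
  exists d : T -> T -> R,
    is_metric d /\
    forall Y : T -> Prop, uncountable_set Y -> ~ monotone d Y.
Proof.
  intros Ho [_ HCA].
  (* Clause (ii) of the axiom gives one scheme that captures systems of every size; the size needed
     below depends on [c]. *)
  destruct (HCA type_m S type_r type_good) as [FF [Hs Hcap]].
  { intros j; lia. }
  { intros B; exists B; lia. }
  pose proof (proj1 type_good) as Ht.
  set (G := branch ltT type_m S type_r FF Ho Ht Hs).
  (* For [l >= 1] the branch value is below [n l = l + 1]; at [l = 0] the numerator in [branch]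
     vanishes because [pred 0 = 0]. *)
  assert (Gle : forall x l, (G x l <= l)%nat).
  { intros x [|l]; unfold G.
    - unfold branch; simpl pred. now rewrite Nat.sub_diag, Nat.Div0.div_0_l.
    - pose proof (proj1 (branch_spec ltT type_m S type_r FF Ho Ht Hs x (S l)
        ltac:(lia))); lia. }
  assert (Hd : is_metric (tree_dist G)).
  { apply tree_dist_metric; auto. intros x y; apply branch_separates. }
  exists (tree_dist G); split; auto.
  intros Y HY [c [Hc [p [Hp Hmono]]]].
  destruct (INR_unbounded (2 * c)) as [M HM].
  (* Three legs with [S M] points each have the codes below [3 * S M]. *)
  destruct (Hcap (3 * S M)%nat ltac:(lia) (fun D => exists x, D = [x] /\ Y x))
    with (N := 0%nat) as [l [_ [Ds [HDs [Hdist Hl]]]]].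
  { intros D [x [-> _]]; split; [discriminate|]. repeat constructor. }
  { now apply singletons_uncountable. }
  destruct Hl as [Hl1 [_ [R [HR [HXi HDelta]]]]].
  (* Distinct singletons are disjoint. With an empty root, position 0 belongs to the tail, so the
     [i]-th captured point has value [i] at level [l]. *)
  assert (HR0 : R = []).
  { destruct R as [|z R]; auto; exfalso.
    destruct HR as [_ [_ [_ [_ [Hint _]]]]].
    destruct (HDs 0%nat ltac:(lia)) as [x [Hx _]].
    destruct (HDs 1%nat ltac:(lia)) as [y [Hy _]].
    destruct (proj2 (Hint 0%nat 1%nat ltac:(lia) ltac:(lia) ltac:(lia) z)
      (or_introl eq_refl)) as [Hzx Hzy].
    apply (Hdist 0%nat 1%nat); try lia.
    rewrite Hx in *; rewrite Hy in *.
    destruct Hzx as [->|[]]; destruct Hzy as [->|[]]; reflexivity. }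
  subst R.
  destruct (HDs 0%nat ltac:(lia)) as [x0 _].
  set (f := fun i => hd x0 (Ds i)).
  assert (Hf : forall i, (i < 3 * S M)%nat -> Ds i = [f i] /\ Y (f i)).
  { intros i Hi; destruct (HDs i Hi) as [x [Hx HxY]]; unfold f.
    rewrite Hx; auto. }
  assert (HG : forall i, (i < 3 * S M)%nat -> G (f i) l = i).
  { intros i Hi; apply branch_Xi; auto.
    apply (HXi i 0%nat (f i)); [lia| |simpl; lia].
    now rewrite (proj1 (Hf i Hi)). }
  assert (Hsplit : forall i j, (i < j)%nat -> (j < 3 * S M)%nat ->
    splits G (f i) (f j) l).
  { intros i j Hij Hj; split; [|rewrite !HG; lia].
    intros k; apply branch_Delta.
    apply (HDelta i j 0%nat); auto.
    - now rewrite (proj1 (Hf i ltac:(lia))).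
    - now rewrite (proj1 (Hf j Hj)). }
  (* All captured pairs split exactly at [l], with children [i] and [j], so they form a tripod
     scaled by [1/(l+1)!]. *)
  apply (tripod_not_monotone (tree_dist G) Y p c (/ INR (fact (S l))) M f);
    auto using inv_fact_pos.
  - intros i Hi; now apply Hf.
  - intros i j Hi Hj Hij.
    rewrite (tree_dist_splits G _ _ l), !HG; auto.
    destruct (Nat.lt_gt_cases i j) as [[H|H] _]; auto.
    now apply splits_sym, Hsplit.
Qed.
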